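(* Let $a,b>-1$, let $\sigma$ be the Jacobi probability measure on $[-1,1]$ with density proportional to $(1-t)^a(1+t)^b$, let $r_n(\lambda)=P_n(\lambda;a,b)$, $n\in\mathbb{Z}_+$, be the orthonormal Jacobi polynomials (orthonormal with respect to $\sigma$, with positive leading coefficients), and let $J_3$ be the corresponding Jacobi matrix. Let $\Theta=(J_3,J_5,\alpha,\beta)$ be the Jacobi-type pencil with $J_5=J_3^2$, $\alpha=\frac{1}{\sqrt{\Delta_1}}$, $\beta=-\frac{s_1+1}{\sqrt{\Delta_1}}$, where $s_j=\int_{\mathbb{R}}x^jd\sigma$ and $\Delta_1=s_0s_2-s_1^2$, and let $\{p_n(\lambda)\}_{n=0}^\infty$ be the associated polynomials of $\Theta$, so that $$p_n(\lambda)=r_n(\lambda)-\frac{r_n(\lambda)-r_n(0)}{\lambda},\qquad n\in\mathbb{Z}_+.$$ Then for every $n\in\mathbb{Z}_+$, $p_n$ is a unique, up to a constant multiple, real polynomial solution of degree $n$ of the following fourth order differential equation: $$-(t+1)t(t-1)^2y^{(4)}(t)+(t-1)\bigl(-(a+b+10)t^2+(b-a)t+4\bigr)y^{(3)}(t)$$ $$+\bigl(-3(2a+2b+8)t^2+(a+9b+22)t+3a-3b\bigr)y''(t)+\bigl(-6(a+b+2)t+2a+6b+8\bigr)y'(t)$$ $$+\lambda_n\bigl(t(t-1)y''(t)+2(2t-1)y'(t)+2y(t)\bigr)=0,$$ where $\lambda_n=n(n+a+b+1)$. Moreover, for every $n\in\mathbb{Z}_+$ there exists a unique $\lambda_n\in\mathbb{R}$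 such that this differential equation (with $\lambda_n$ regarded as a real parameter) has a real polynomial solution of degree $n$.
   Context: $\mathbb{Z}_+$ denotes the non-negative integers. A Jacobi-type pencil is a tuple $\Theta=(J_3,J_5,\alpha,\beta)$, where $\alpha>0$, $\beta\in\mathbb{R}$, $J_3$ is a semi-infinite real symmetric tridiagonal (Jacobi) matrix, rows and columns indexed by $\mathbb{Z}_+$, with real diagonal entries and positive entries $(J_3)_{k,k+1}=(J_3)_{k+1,k}$, and $J_5$ is a semi-infinite real symmetric five-diagonal matrix with positive entries $(J_5)_{k,k+2}=(J_5)_{k+2,k}$, $k\in\mathbb{Z}_+$. The associated polynomials of $\Theta$ are the unique system of polynomials $\{p_n(\lambda)\}_{n=0}^\infty$ with $p_0(\lambda)=1$, $p_1(\lambda)=\alpha\lambda+\beta$ and $(J_5-\lambda J_3)(p_0(\lambda),p_1(\lambda),p_2(\lambda),\ldots)^T=0$. The Jacobi matrix $J_3$ corresponding to $\{r_n\}$ is the one with $J_3(r_0(\lambda),r_1(\lambda),\ldots)^T=\lambda(r_0(\lambda),r_1(\lambda),\ldots)^T$. The quotient $\frac{r_n(\lambda)-r_n(0)}{\lambda}$ is understood as a polynomial (limit value at $\lambda=0$). The orthonormal Jacobi polynomials $r_n$ satisfy $(1-t^2)y''+(b-a-(a+b+2)t)y'+n(n+a+b+1)y=0$. *)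

(* Defs.v *)
From HB Require Import structures.
From mathcomp Require Import all_boot all_order all_algebra.
From mathcomp Require Import all_classical all_reals all_analysis.
Set Implicit Arguments.
Unset Strict Implicit.
Unset Printing Implicit Defensive.
Import Order.TTheory GRing.Theory Num.Theory.
Import numFieldNormedType.Exports.
Local Open Scope classical_set_scope.
Local Open Scope ring_scope.

(* Semi-infinite matrices and vectors, indexed by the natural numbers.  In the
   two products, \sum_(k \in [set: nat]) is the finite-support sum of fsbigop;
   it is the true sum as soon as the left factor has finitely many nonzero
   entries in each row, in particular for banded matrices. *)
Definition simx (S : Type) : Type := nat -> nat -> S.

Definition simx_mul (S : nzRingType) (A B : simx S) : simx S :=
  fun i j => \sum_(k \in [set: nat]) (A i k * B k j).

Definition simx_mulv (S : nzRingType) (A : simx S) (v : nat -> S) : nat -> S :=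
  fun i => \sum_(k \in [set: nat]) (A i k * v k).

Definition jacobi_matrix (R : numDomainType) (J : simx R) : Prop :=
  [/\ forall i j : nat, J i j = J j i,
      forall i j : nat, (i.+1 < j)%N -> J i j = 0
    & forall k : nat, 0 < J k k.+1].

Definition five_diagonal_matrix (R : numDomainType) (J : simx R) : Prop :=
  [/\ forall i j : nat, J i j = J j i,
      forall i j : nat, (i.+2 < j)%N -> J i j = 0
    & forall k : nat, 0 < J k k.+2].

Record pencil (R : Type) := Pencil {
  pencil_J3 : simx R;
  pencil_J5 : simx R;
  pencil_alpha : R;
  pencil_beta : R
}.

Definition jacobi_type_pencil (R : numDomainType) (Theta : pencil R) : Prop :=
  [/\ 0 < pencil_alpha Theta,
      jacobi_matrix (pencil_J3 Theta)
    & five_diagonal_matrix (pencil_J5 Theta)].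

(* (J5 - lambda J3) (p_0, p_1, ...)^T = 0 is an identity between vectors of
   polynomials in the indeterminate lambda = 'X. *)
Definition associated_polynomials (R : numDomainType) (Theta : pencil R)
    (p : nat -> {poly R}) : Prop :=
  [/\ p 0 = 1,
      p 1 = pencil_alpha Theta *: 'X + (pencil_beta Theta)%:P
    & simx_mulv
        (fun i j => (pencil_J5 Theta i j)%:P - 'X * (pencil_J3 Theta i j)%:P) p
      = fun=> 0].

Definition jacobi_matrix_of (R : numDomainType) (r : nat -> {poly R})
    (J : simx R) : Prop :=
  jacobi_matrix J /\ simx_mulv (fun i j => (J i j)%:P) r = fun n => 'X * r n.

(* The values of powR at the base 0 (endpoints of the interval) do not matter,
   being taken on a Lebesgue-null set.  The constant c is determined by
   sigma being a probability. *)
Definition jacobi_measure (R : realType) (a b : R)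
    (sigma : probability (measurableTypeR R) R) : Prop :=
  exists2 c : R, 0 < c &
    forall A : set (measurableTypeR R), measurable A ->
      sigma A = (\int[@lebesgue_measure R]_(x in A `&` `[(-1)%R, 1%R])
                   (c * ((1 - x) `^ a * (1 + x) `^ b))%:E)%E.

Definition orthonormal_polynomials (R : realType)
    (sigma : probability (measurableTypeR R) R) (r : nat -> {poly R}) : Prop :=
  [/\ forall n : nat, size (r n) = n.+1,
      forall n : nat, 0 < lead_coef (r n)
    & forall m n : nat,
        (\int[sigma]_x ((r m).[x] * (r n).[x])%:E = ((m == n)%:R)%:E)%E].

Definition moment (R : realType) (sigma : probability (measurableTypeR R) R)
    (j : nat) : R := \int[sigma]_x (x ^+ j).

Definition Delta1 (R : realType) (sigma : probability (measurableTypeR R) R)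
    : R :=
  moment sigma 0 * moment sigma 2 - moment sigma 1 ^+ 2.

Definition pencil_of_jacobi (R : realType)
    (sigma : probability (measurableTypeR R) R) (J3 : simx R) : pencil R :=
  {| pencil_J3 := J3;
     pencil_J5 := simx_mul J3 J3;
     pencil_alpha := 1 / Num.sqrt (Delta1 sigma);
     pencil_beta := - ((moment sigma 1 + 1) / Num.sqrt (Delta1 sigma)) |}.

Definition solves_ode (R : realType) (a b lambda : R) (y : {poly R}) : Prop :=
  forall t : R,
    - (t + 1) * t * (t - 1) ^+ 2 * y^`(4).[t]
    + (t - 1) * (- (a + b + 10) * t ^+ 2 + (b - a) * t + 4) * y^`(3).[t]
    + (- 3 * (2 * a + 2 * b + 8) * t ^+ 2 + (a + 9 * b + 22) * t
       + 3 * a - 3 * b) * y^`(2).[t]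
    + (- 6 * (a + b + 2) * t + 2 * a + 6 * b + 8) * y^`(1).[t]
    + lambda * (t * (t - 1) * y^`(2).[t] + 2 * (2 * t - 1) * y^`(1).[t]
                + 2 * y.[t])
    = 0.

(* Main.v *)
(* Let L y = (1 - t^2) y'' + (b - a - (a + b + 2) t) y' and let w be the Jacobi
   weight.  For a polynomial h, the function (1 - t^2) w h vanishes at both
   endpoints and has derivative w ((1 - t^2) h' + (b - a - (a + b + 2) t) h),
   so the latter has integral 0; with h = f' g - f g' this says that L is
   symmetric for the inner product of sigma.  As L is triangular on polynomials
   graded by degree, orthonormality forces L r_n + lambda_n r_n = 0.

   The Jacobi matrix acts on (r_n) as multiplication by t, hence on the
   difference quotients (r_n - r_n(0)) / t as removal of a factor t; this gives
   the recurrence (J3^2 - t J3) p = 0 for p_n = r_n - (r_n - r_n(0)) / t, and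
   that recurrence determines p from p_0 and p_1.

   Finally u = t p_n satisfies u = (t - 1) r_n + c with c constant.  Rewriting
   the Jacobi equation for r_n in terms of u - c leaves a second-order operator
   in u equal to c times a linear polynomial; differentiating twice kills it,
   and the result is the fourth-order equation.  Its coefficient of highest
   degree determines lambda, and lambda_m = lambda_n only for m = n, whence
   both uniqueness claims. *)

Require Import Defs.
From HB Require Import structures.
From mathcomp Require Import all_boot all_order all_algebra.
From mathcomp Require Import all_classical all_reals all_analysis.
From mathcomp Require Import measurable_realfun ring lra.
Set Implicit Arguments.
Unset Strict Implicit.
Unset Printing Implicit Defensive.
Import Order.TTheory GRing.Theory Num.Theory.
Import numFieldNormedType.Exports.
Local Open Scope classical_set_scope.
Local Open Scope ring_scope.

(** * The differential operators *)

(** In characteristic zero the naturals below [size p] are distinct, hence too many roots for a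
    nonzero [p]. *)
Lemma horner_eq0 (K : numDomainType) (p : {poly K}) :
  (forall t, p.[t] = 0) -> p = 0.
Proof.
move=> p0; apply/eqP; apply: contraT => p_neq0.
have := @max_poly_roots _ p [seq i%:R | i <- iota 0 (size p)] p_neq0.
rewrite size_map size_iota ltnn; apply.
  by apply/allP => x _; rewrite rootE p0.
by rewrite map_inj_uniq ?iota_uniq// => i j /eqP; rewrite eqr_nat => /eqP.
Qed.

Lemma size_sub_lead (K : fieldType) (p q : {poly K}) n :
  size p = n.+1 -> size q = n.+1 ->
  (size (p - (lead_coef p / lead_coef q) *: q)%R <= n)%N.
Proof.
move=> sp sq; apply/leq_sizeP => j; rewrite coefB coefZ.
rewrite leq_eqVlt => /orP[/eqP <-|nj]; last first.
  by rewrite !nth_default ?sp ?sq// mulr0 subrr.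
have : lead_coef q != 0 by rewrite lead_coef_eq0 -size_poly_eq0 sq.
by rewrite !lead_coefE sp sq /= => q0; rewrite divfK ?subrr.
Qed.

Section JacobiOperators.
Context {K : comNzRingType}.
Implicit Types (a b l c : K) (u r y : {poly K}).

(** For the weight w = (1 - t)^a (1 + t)^b this is ((1 - t^2) w r)' / w, written without w. *)
Definition pearson_op a b r : {poly K} :=
  (1 - 'X ^+ 2) * r^`() + ((b - a)%:P - (a + b + 2)%:P * 'X) * r.

Definition jacobi_op a b r : {poly K} := pearson_op a b r^`().

(* The operator u |-> (t - 1)^2 (L + l) (u / (t - 1)), which has polynomial
   coefficients; see [shifted_opE]. *)
Definition shifted_op a b l u : {poly K} :=
  - ('X ^+ 3 - 'X ^+ 2 - 'X + 1) * u^`()^`()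
  + (- (a + b)%:P * 'X ^+ 2 + (2 + 2 * b)%:P * 'X - (2 + b - a)%:P) * u^`()
  + ((a + b + l)%:P * 'X + (a - b - 2 - l)%:P) * u.

Lemma shifted_opE a b l r c :
  shifted_op a b l (('X - 1) * r + c%:P) =
  ('X - 1) ^+ 2 * (jacobi_op a b r + l%:P * r)
  + c%:P * ((a + b + l)%:P * 'X + (a - b - 2 - l)%:P).
Proof.
rewrite /shifted_op /jacobi_op /pearson_op !poly.derivE.
rewrite !(polyCD, polyCN, polyCB, polyCM, polyC1).
ring.
Qed.

Lemma shifted_op_deriv2 a b l r c : jacobi_op a b r + l%:P * r = 0 ->
  (shifted_op a b l (('X - 1) * r + c%:P))^`()^`() = 0.
Proof.
move=> r0; rewrite shifted_opE r0 mulr0 add0r !poly.derivE.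
by rewrite !(mul0r, mulr0, add0r, addr0, derivC, mulr1).
Qed.

End JacobiOperators.

(** * The fourth-order equation and its polynomial solutions *)

Section JacobiTypeOde.
Context {R : realType}.
Implicit Types (a b l : R) (y r : {poly R}).

Lemma solves_odeE a b l y :
  solves_ode a b l y <-> (shifted_op a b l ('X * y))^`()^`() = 0.
Proof.
have odeE : (shifted_op a b l ('X * y))^`()^`() =
    - ('X + 1) * 'X * ('X - 1) ^+ 2 * y^`(4)
    + ('X - 1) * (- (a%:P + b%:P + 10) * 'X ^+ 2 + (b%:P - a%:P) * 'X + 4)
      * y^`(3)
    + (- 3 * (2 * a%:P + 2 * b%:P + 8) * 'X ^+ 2
       + (a%:P + 9 * b%:P + 22) * 'X + 3 * a%:P - 3 * b%:P) * y^`(2)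
    + (- 6 * (a%:P + b%:P + 2) * 'X + 2 * a%:P + 6 * b%:P + 8) * y^`(1)
    + l%:P * ('X * ('X - 1) * y^`(2) + 2 * (2 * 'X - 1) * y^`(1) + 2 * y).
  rewrite /shifted_op !exprS !expr0 !(polyCD, polyCN, polyCB, polyCM, polyC1).
  rewrite !poly.derivE.
  rewrite -[y^`(4)]/(y^`()^`()^`()^`()) -[y^`(3)]/(y^`()^`()^`()).
  rewrite -[y^`(2)]/(y^`()^`()) -[y^`(1)]/(y^`()).
  (* With the Leibniz rule exhausted, the derivatives of [y] are independent atoms and only a
     commutative ring identity remains. *)
  move: (y^`()^`()^`()^`()) (y^`()^`()^`()) (y^`()^`()) (y^`()) => y4 y3 y2 y1.
  move: a%:P b%:P l%:P 'X => A B L X.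
  ring.
have hornerE2 := (hornerD, hornerN, hornerM, hornerMn, horner_exp, hornerX,
  hornerC).
split=> [ode|op0 t]; last first.
  by rewrite -(horner0 t) -op0 odeE !hornerE2.
by apply: horner_eq0 => t; rewrite -[RHS](ode t) odeE !hornerE2.
Qed.

(** [shifted_op] raises degrees by at most one, so only the leading term of ['X * y] reaches index n
    + 2; its factor is -(n + 1) n - (a + b)(n + 1) + (a + b + l). *)
Lemma coef_shifted_op a b l n y : size y = n.+1 ->
  (shifted_op a b l ('X * y))`_n.+2 =
  (l - n%:R * (n%:R + a + b + 1)) * lead_coef y.
Proof.
move=> sy; rewrite lead_coefE sy /=.
have y0 k : (n < k)%N -> y`_k = 0 by move=> nk; rewrite nth_default// sy.
have -> : shifted_op a b l ('X * y) =
    - ('X^3 * ('X * y)^`()^`()) + 'X^2 * ('X * y)^`()^`()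
    + 'X * ('X * y)^`()^`() - ('X * y)^`()^`()
    - (a + b)%:P * ('X^2 * ('X * y)^`()) + (2 + 2 * b)%:P * ('X * ('X * y)^`())
    - (2 + b - a)%:P * ('X * y)^`()
    + (a + b + l)%:P * ('X * ('X * y)) + (a - b - 2 - l)%:P * ('X * y).
  by rewrite /shifted_op; ring.
rewrite !(coefD, coefN, coefB, coefCM, coefXnM, coefXM, coef_deriv) /=.
rewrite !subSS !subn0 (y0 n.+1)// (y0 n.+2) 1?(y0 n.+3)//; last by rewrite leqW.
(* For n = 0 the index n + 2 lies below 3, so the ['X^3] term contributes nothing. *)
case: n sy y0 => [|n] sy y0 /=; first by ring.
rewrite subn1 /=; ring.
Qed.

(** Two derivatives carry the coefficient of index n + 2 to index n with a nonzero integer factor,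
    so it must vanish. *)
Lemma solves_ode_eigenvalue a b l n y : size y = n.+1 -> solves_ode a b l y ->
  l = n%:R * (n%:R + a + b + 1).
Proof.
move=> sy /solves_odeE /(congr1 (fun p : {poly R} => p`_n)) /eqP.
rewrite coef0 !coef_deriv !mulrn_eq0 /= (coef_shifted_op _ _ _ sy) mulf_eq0.
by rewrite lead_coef_eq0 -size_poly_eq0 sy orbF subr_eq0 => /eqP.
Qed.

Lemma solves_odeB a b l y (z : {poly R}) :
  solves_ode a b l y -> solves_ode a b l z -> solves_ode a b l (y - z).
Proof.
move=> yP zP t; have := congr2 (fun u v => u - v) (yP t) (zP t).
rewrite subr0 => <-.
by rewrite !derivnB !hornerD !hornerN; ring.
Qed.

Lemma solves_odeZ a b l c y : solves_ode a b l y -> solves_ode a b l (c *: y).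
Proof.
move=> yP t; have := congr1 ( *%R c) (yP t); rewrite mulr0 => <-.
by rewrite !derivnZ !hornerZ; ring.
Qed.

(** The difference is (m - n)(m + n + a + b + 1), and the second factor is positive as soon as m + n
    >= 1, because a + b > -2. *)
Lemma eigenvalue_inj a b m n : -1 < a -> -1 < b ->
  m%:R * (m%:R + a + b + 1) = n%:R * (n%:R + a + b + 1) -> m = n.
Proof.
move=> a1 b1; wlog mn : m n / (m <= n)%N => [h mnE|].
  by case/orP: (leq_total m n) => /h -> //; exact/esym.
move=> /eqP; rewrite -subr_eq0.
have -> : m%:R * (m%:R + a + b + 1) - n%:R * (n%:R + a + b + 1) =
  (m%:R - n%:R) * (m%:R + n%:R + a + b + 1) :> R by ring.
rewrite mulf_eq0 subr_eq0 eqr_nat => /orP[/eqP//|].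
case: n mn => [|n] mn; first by move: mn; rewrite leqn0 => /eqP.
have := ler0n R m; have := ler0n R n; rewrite -[n.+1%:R]natr1.
by move=> n0 m0 /eqP ?; exfalso; lra.
Qed.

(** Cancelling leading terms leaves a solution [d] of lower degree for the same parameter; if
    nonzero, its degree would share the eigenvalue of n. *)
Lemma solves_ode_unique a b n y (z : {poly R}) : -1 < a -> -1 < b ->
  size y = n.+1 -> size z = n.+1 ->
  solves_ode a b (n%:R * (n%:R + a + b + 1)) y ->
  solves_ode a b (n%:R * (n%:R + a + b + 1)) z ->
  exists c, y = c *: z.
Proof.
move=> a1 b1 sy sz yP zP.
exists (lead_coef y / lead_coef z); apply/eqP; rewrite -subr_eq0.
set d := y - _.
have dP : solves_ode a b (n%:R * (n%:R + a + b + 1)) d.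
  exact/solves_odeB/solves_odeZ.
have sd : (size d <= n)%N by exact: size_sub_lead.
apply: contraT => d0.
have sd1 : size d = (size d).-1.+1 by rewrite prednK// size_poly_gt0.
have /(eigenvalue_inj a1 b1) dn := solves_ode_eigenvalue sd1 dP.
by move: sd; rewrite sd1 -dn ltnn.
Qed.

End JacobiTypeOde.

(** * Jacobi-type pencils *)

Lemma sumr_setT_ord (V : nmodType) (F : nat -> V) (N : nat) :
  (forall k, (N <= k)%N -> F k = 0) ->
  \sum_(k \in [set: nat]) F k = \sum_(k < N) F k.
Proof.
move=> F0; rewrite fsbig_ord; apply/esym/fsbig_widen => // k [_ /= /negP].
by rewrite -leqNgt => /F0.
Qed.

Section JacobiMatrix.
Context {R : numDomainType}.
Implicit Types (J : simx R) (v : nat -> {poly R}).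

Lemma jacobi_matrix_eq0 J i j : jacobi_matrix J ->
  (i.+1 < j)%N || (j.+1 < i)%N -> J i j = 0.
Proof. by move=> [Jsym J0 _] /orP[|] ij; [|rewrite Jsym]; exact: J0. Qed.

Lemma jacobi_matrix_mulv J v i N : jacobi_matrix J -> (i.+1 < N)%N ->
  simx_mulv (fun i j => (J i j)%:P) v i = \sum_(k < N) J i k *: v k.
Proof.
move=> HJ iN; rewrite /simx_mulv (sumr_setT_ord (N := N)) => [|k Nk].
  by under eq_bigr do rewrite mul_polyC.
by rewrite jacobi_matrix_eq0 ?mul0r// (leq_trans iN Nk).
Qed.

Lemma jacobi_matrix_mul J i j N : jacobi_matrix J -> (i.+1 < N)%N ->
  simx_mul J J i j = \sum_(k < N) J i k * J k j.
Proof.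
move=> HJ iN; rewrite /simx_mul (sumr_setT_ord (N := N))// => k Nk.
by rewrite jacobi_matrix_eq0 ?mul0r// (leq_trans iN Nk).
Qed.

Lemma five_diagonal_sqr J : jacobi_matrix J ->
  five_diagonal_matrix (simx_mul J J).
Proof.
move=> HJ; have [Jsym _ Jgt0] := HJ; split => [i j|i j ij|k].
- rewrite !(@jacobi_matrix_mul _ _ _ (maxn i j).+2) ?ltnS ?leq_maxl ?leq_maxr//.
  by apply: eq_bigr => k _; rewrite mulrC Jsym (Jsym k).
- rewrite (@jacobi_matrix_mul _ _ _ i.+2)// big1// => k _.
  by rewrite (@jacobi_matrix_eq0 _ k j)// ?mulr0// (leq_trans _ ij)// ltnS.
(* The only intermediate index linking k to k + 2 is k + 1, so the entry is a product of two
   positive ones. *)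
- rewrite (@jacobi_matrix_mul _ _ _ k.+3)// (bigD1 (inord k.+1)) ?inordK//=.
  rewrite big1 ?addr0 ?mulr_gt0// => l; rewrite -val_eqE /= inordK// neq_ltn.
  move=> /orP[|] lk.
    by rewrite (@jacobi_matrix_eq0 _ l)// ?mulr0// ltnS lk.
  by rewrite (@jacobi_matrix_eq0 _ k l)// ?mul0r// lk.
Qed.

(** Associativity reduces to exchanging finite sums: row i of [J] stops before column i + 2 and row
    i of its square before i + 3, which also covers the rows j < i + 2 of [J]. *)
Lemma simx_mulv_sqr J v : jacobi_matrix J ->
  simx_mulv (fun i j => (simx_mul J J i j)%:P) v =
  simx_mulv (fun i j => (J i j)%:P) (simx_mulv (fun i j => (J i j)%:P) v).
Proof.
move=> HJ; apply/funext => i.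
have [_ J50 _] := five_diagonal_sqr HJ.
rewrite /simx_mulv (sumr_setT_ord (N := i.+3)) => [|k ik]; last first.
  by rewrite J50 ?mul0r.
rewrite -/(simx_mulv (fun i j => (J i j)%:P) _ i).
rewrite (@jacobi_matrix_mulv _ _ _ i.+2)//.
transitivity (\sum_(k < i.+3) \sum_(j < i.+2) J i j *: (J j k *: v k)).
  apply: eq_bigr => k _; rewrite (@jacobi_matrix_mul _ _ _ i.+2)//.
  rewrite mul_polyC scaler_suml.
  by apply: eq_bigr => j _; rewrite scalerA.
rewrite exchange_big; apply: eq_bigr => j _.
rewrite -/(simx_mulv (fun i j => (J i j)%:P) _ j).
by rewrite (@jacobi_matrix_mulv _ _ _ i.+3) ?scaler_sumr// !ltnS -ltnS.
Qed.

(** In row n the index n + 2 occurs only through the positive scalar [pencil_J5 Theta n n.+2], since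
    J3 vanishes there; the row thus expresses p_(n+2) through earlier terms. *)
Lemma associated_polynomials_unique (Theta : pencil R) (p q : nat -> {poly R}) :
  jacobi_type_pencil Theta ->
  associated_polynomials Theta p -> associated_polynomials Theta q -> p = q.
Proof.
move=> [_ HJ3 [_ J50 J5gt0]] [p0 p1 pT] [q0 q1 qT]; apply/funext.
have row (w : nat -> {poly R}) n : simx_mulv (fun i j =>
      (pencil_J5 Theta i j)%:P - 'X * (pencil_J3 Theta i j)%:P) w = (fun=> 0) ->
    (pencil_J5 Theta n n.+2) *: w n.+2 = - (\sum_(k < n.+2)
      ((pencil_J5 Theta n k)%:P - 'X * (pencil_J3 Theta n k)%:P) * w k).
  move=> /(congr1 (fun f => f n)); rewrite /simx_mulv.
  rewrite (sumr_setT_ord (N := n.+3)) => [|k nk]; last first.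
    rewrite J50// (jacobi_matrix_eq0 (i := n) (j := k) HJ3).
      by rewrite mulr0 subrr mul0r.
    by rewrite ltnW.
  rewrite big_ord_recr/= (jacobi_matrix_eq0 (i := n) (j := n.+2) HJ3) ?leqnn//.
  rewrite polyC0 mulr0 subr0 mul_polyC addrC => /eqP.
  by rewrite addr_eq0 => /eqP.
elim/ltn_ind => -[|[|n]] IH; rewrite ?p0 ?p1//.
have J5n : pencil_J5 Theta n n.+2 != 0 by rewrite gt_eqF.
have : pencil_J5 Theta n n.+2 *: (p n.+2 - q n.+2) = 0.
  rewrite scalerBr !row//; apply/eqP; rewrite subr_eq0; apply/eqP.
  by congr (- _); apply: eq_bigr => k _; rewrite IH.
move/eqP; rewrite -mul_polyC mulf_eq0 polyC_eq0 (negbTE J5n) subr_eq0.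
by move/eqP.
Qed.

End JacobiMatrix.

(** * Difference quotients and the pencil recurrence *)

Section DiagonalShift.
Context {R : realFieldType}.
Implicit Types (f : {poly R}) (r : nat -> {poly R}).

(** As a coefficient shift, the quotient is visibly linear in [f] and inverts multiplication by
    ['X]. *)
Lemma difference_quotient f : (f - f.[0]%:P) %/ 'X = drop_poly 1 f.
Proof.
rewrite -['X in LHS]expr1 -Pdiv.IdomainMonic.drop_poly_divp.
by apply/polyP => i; rewrite !coef_drop_poly coefB coefC addn1 subr0.
Qed.

Lemma mulX_difference_quotient f : 'X * ((f - f.[0]%:P) %/ 'X) = f - f.[0]%:P.
Proof.
rewrite difference_quotient horner_coef0 mulrC; apply/polyP => -[|i].
  by rewrite coefMX coefB coefC subrr.
by rewrite coefMX coefB coefC /= coef_drop_poly addn1 subr0.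
Qed.

(** With D the vector of quotients, J r = X r gives J D = r. Hence q = r - D satisfies J q = (X - 1)
    r and J^2 q = X (X - 1) r = X J q. *)
Lemma recurrence_shift (r : nat -> {poly R}) (J : simx R) :
  jacobi_matrix_of r J ->
  simx_mulv (fun i j => (simx_mul J J i j)%:P - 'X * (J i j)%:P)
    (fun n => r n - (r n - (r n).[0]%:P) %/ 'X) = fun=> 0.
Proof.
move=> [HJ rec].
have HD : simx_mulv (fun i j => (J i j)%:P)
    (fun n => (r n - (r n).[0]%:P) %/ 'X) = r.
  apply/funext => n; rewrite (@jacobi_matrix_mulv _ _ _ _ n.+2)//.
  under eq_bigr do rewrite difference_quotient -drop_polyZ.
  rewrite -drop_poly_sum -(jacobi_matrix_mulv r HJ)// rec.
  by rewrite mulrC -['X]expr1 drop_polyMXn_id.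
set q := (fun n => r n - (r n - (r n).[0]%:P) %/ 'X).
have mulvB (u v : nat -> {poly R}) : simx_mulv (fun i j => (J i j)%:P)
    (fun n => u n - v n) =
    fun n => simx_mulv (fun i j => (J i j)%:P) u n -
             simx_mulv (fun i j => (J i j)%:P) v n.
  apply/funext => n; rewrite !(@jacobi_matrix_mulv _ _ _ _ n.+2)// -sumrB.
  by apply: eq_bigr => k _; rewrite scalerBr.
have J3q : simx_mulv (fun i j => (J i j)%:P) q = fun n => 'X * r n - r n.
  by rewrite mulvB HD rec.
have J5q : simx_mulv (fun i j => (simx_mul J J i j)%:P) q =
    fun n => 'X * ('X * r n - r n).
  rewrite simx_mulv_sqr// J3q mulvB rec; apply/funext => n.
  rewrite mulrBr (@jacobi_matrix_mulv _ _ _ _ n.+2)//; congr (_ - _).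
  under eq_bigr do rewrite scalerAr.
  by rewrite -mulr_sumr -(jacobi_matrix_mulv r HJ)// rec.
apply/funext => n; have [_ J50 _] := five_diagonal_sqr HJ.
(* Both products are cut at n + 3, beyond the bands of [J] and of its square, so that they combine
   termwise. *)
move: (congr1 (@^~ n) J5q) (congr1 (@^~ n) J3q).
rewrite /simx_mulv !(sumr_setT_ord (N := n.+3)).
- under [X in _ -> _ -> X = _]eq_bigr do rewrite mulrBl -mulrA.
  by rewrite sumrB -mulr_sumr => -> ->; rewrite subrr.
- move=> k nk; rewrite J50// (jacobi_matrix_eq0 (i := n) (j := k) HJ).
    by rewrite mulr0 subrr mul0r.
  by rewrite ltnW.
- move=> k nk; rewrite (jacobi_matrix_eq0 (i := n) (j := k) HJ) ?mul0r//.
  by rewrite ltnW.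
- by move=> k nk; rewrite J50// mul0r.
Qed.
End DiagonalShift.

(** * Orthonormal polynomials *)

Section OrthonormalPolynomials.
Context {K : numFieldType}.
Context (E : {scalar {poly K}}) (r : nat -> {poly K}).
Context (size_r : forall n, size (r n) = n.+1)
  (Er : forall m n, E (r m * r n) = (m == n)%:R).

(** Since each [r m] has degree exactly m, leading terms of [g] can be removed one by one by
    multiples of [r m] with m < n. *)
Lemma orthonormal_lower n (g : {poly K}) : (size g <= n)%N -> E (g * r n) = 0.
Proof.
move=> sg; move: {2}(size g) (leqnn (size g)) => m.
elim: m => [|m IH] in g sg *.
  by rewrite leqn0 size_poly_eq0 => /eqP ->; rewrite mul0r linear0.
rewrite leq_eqVlt => /orP[/eqP sgm|]; last exact: IH.
have sd := size_sub_lead sgm (size_r m); set k := _ / _ in sd.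
rewrite -(subrK (k *: r m) g) mulrDl linearD -scalerAl scalarZ Er.
have mn : (m < n)%N by rewrite -sgm.
by rewrite (ltn_eqF mn) mulr0 addr0 IH// (leq_trans sd)// ltnW.
Qed.

Lemma orthonormal_eq0 n (g : {poly K}) : (size g <= n)%N ->
  (forall k, (k < n)%N -> E (g * r k) = 0) -> g = 0.
Proof.
move=> sg gr; apply/eqP; apply: contraT => g0.
have sgk : size g = (size g).-1.+1 by rewrite prednK// size_poly_gt0.
have sd := size_sub_lead sgk (size_r _); set k := _ / _ in sd.
(* Testing against the [r] of the same degree as [g] yields the quotient of the two leading
   coefficients, which is nonzero. *)
have := gr (size g).-1; rewrite -sgk sg => /(_ isT) /eqP.
rewrite -{1}(subrK (k *: r (size g).-1) g) mulrDl linearD -scalerAl scalarZ.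
rewrite Er eqxx orthonormal_lower// add0r mulr1 mulf_eq0 invr_eq0.
by rewrite !lead_coef_eq0 (negbTE g0) -size_poly_eq0 size_r.
Qed.

Context (a b : K).
Context (pearson : forall h : {poly K}, E (pearson_op a b h) = 0).

(** This makes the triangularity explicit: no coefficient of index below i enters, and the diagonal
    entry is minus the eigenvalue. *)
Lemma coef_jacobi_op (y : {poly K}) i : (jacobi_op a b y)`_i =
  y`_i.+2 *+ (i.+2 * i.+1) + (b - a) * y`_i.+1 *+ i.+1
  - i%:R * (i%:R + a + b + 1) * y`_i.
Proof.
have -> : jacobi_op a b y = y^`()^`() - 'X^2 * y^`()^`() + (b - a)%:P * y^`()
    - (a + b + 2)%:P * ('X * y^`()) by rewrite /jacobi_op /pearson_op; ring.
rewrite !(coefD, coefN, coefB, coefCM, coefXnM, coefXM, coef_deriv) /=.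
case: i => [|[|i]] /=; [ring|ring|rewrite !subSS subn0; ring].
Qed.

(** Lagrange's identity: (L f) g - f (L g) is [pearson_op] of the Wronskian f' g - f g', which [E]
    kills. *)
Lemma jacobi_op_symmetric f g :
  E (jacobi_op a b f * g) = E (f * jacobi_op a b g).
Proof.
apply/eqP; rewrite -subr_eq0 -linearB/= -(pearson (f^`() * g - f * g^`())).
apply/eqP; congr (E _); rewrite /jacobi_op /pearson_op !poly.derivE; ring.
Qed.

(** The eigenvalue cancels the coefficient of degree n. Against [r k] with k < n, symmetry moves L
    onto [r k], whose image still has degree below n. *)
Lemma orthonormal_jacobi_op n :
  jacobi_op a b (r n) + (n%:R * (n%:R + a + b + 1))%:P * r n = 0.
Proof.
apply: (@orthonormal_eq0 n) => [|k kn].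
  apply/leq_sizeP => j nj; rewrite coefD coef_jacobi_op coefCM.
  move: nj; rewrite leq_eqVlt => /orP[/eqP <-|nj].
    by rewrite (nth_default _ (_ : size (r n) <= n.+1)%N) ?size_r//
      (nth_default _ (_ : size (r n) <= n.+2)%N) ?size_r//; ring.
  by rewrite !nth_default ?size_r ?leqW//; ring.
rewrite mulrDl linearD /= jacobi_op_symmetric mul_polyC -scalerAl scalarZ Er.
rewrite (gtn_eqF kn) mulr0 addr0 mulrC orthonormal_lower//.
apply/leq_sizeP => j nj; rewrite coef_jacobi_op !nth_default ?size_r//.
- by ring.
- exact: leq_trans kn nj.
- by rewrite leqW// (leq_trans kn nj).
- by rewrite !leqW// (leq_trans kn nj).
Qed.

End OrthonormalPolynomials.

(** * The Jacobi measure *)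

(** The Radon-Nikodym derivative of [nu] agrees with [w] almost everywhere, both having integral
    [nu A] over every measurable [A]. Integrability of the product follows from the change of
    measure applied to |f|. *)
Lemma density_integral d (T : measurableType d) (R : realType)
    (nu : {finite_measure set T -> \bar R})
    (mu : {sigma_finite_measure set T -> \bar R}) (w f : T -> \bar R) :
  measurable_fun setT w -> (forall x, 0 <= w x)%E ->
  (forall A, measurable A -> nu A = \int[mu]_(x in A) w x)%E ->
  nu.-integrable setT f ->
  mu.-integrable setT (f \* w)%E /\
  (\int[nu]_x f x = \int[mu]_x (f x * w x))%E.
Proof.
move=> mw w0 nuE.
have numu : nu `<< mu.
  apply/null_content_dominatesP => A mA muA0; rewrite nuE//.
  by apply: null_set_integral => //; exact: measurable_funTS.
have iw : mu.-integrable setT w.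
  apply/integrableP; split=> //.
  under eq_integral do rewrite gee0_abs//.
  by rewrite -nuE// ltey_eq fin_num_measure.
have changeE g : nu.-integrable setT g ->
    (\int[nu]_x g x = \int[mu]_x (g x * w x))%E.
  move=> ig; rewrite -(Radon_Nikodym_change_of_variables numu)//=.
  have mg := measurable_int _ ig.
  have RNi : mu.-integrable setT 
      (Radon_Nikodym (charge_of_finite_measure nu) mu).
    exact: Radon_Nikodym_integrable.
  apply: ae_eq_integral => //.
  - by apply: emeasurable_funM => //; exact: measurable_int RNi.
  - exact: emeasurable_funM.
  - apply: ae_eqe_mul2l => /=; apply: integral_ae_eq => // A _ mA.
    by rewrite -nuE// -Radon_Nikodym_integral.
move=> fi; split; last exact: changeE.
have mf := measurable_int _ fi.
apply/integrableP; split; first exact: emeasurable_funM.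
under eq_integral do rewrite abseM [X in (_ * X)%E]gee0_abs//.
rewrite -changeE; last exact: integrable_abse.
by case/integrableP : fi.
Qed.

(** Continuity of [f] is asked only inside, since the Jacobi weight is unbounded at an endpoint with
    a negative exponent. The integral [G] and [F] have equal derivatives inside, so by the mean
    value theorem [G - F] takes equal values at the two ends. *)
Lemma integrable_FTC2 (R : realType) (f F : R -> R) (a b : R) : (a < b)%R ->
  (@lebesgue_measure R).-integrable `[a, b] (EFin \o f) ->
  {in `]a, b[, continuous f} ->
  (forall x : R, x \in `]a, b[ -> is_derive x 1 F (f x)) ->
  {within `[a, b], continuous F} ->
  \int[@lebesgue_measure R]_(x in `[a, b]) f x = F b - F a.
Proof.
move=> ab fi fc F'f Fc.
pose G x := parameterized_integral (@lebesgue_measure R) a x f.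
have G'f (x : R) : x \in `]a, b[ -> is_derive x 1 G (f x).
  move=> xab; have := xab; rewrite in_itv/= => /andP[ax xb].
  have [dG G'] := continuous_FTC1_closed xb fi ax (fc x xab).
  by apply: DeriveDef; rewrite -?derive1E.
have GF' (x : R) : x \in `]a, b[ -> is_derive x 1 (G - F) (cst 0 x).
  move=> xab; rewrite /cst -(subrr (f x)); apply: is_deriveB.
    exact: G'f.
  exact: F'f.
have GFc : {within `[a, b], continuous (G - F)}.
  move=> x; apply: continuousB; last exact: Fc.
  exact: (parameterized_integral_continuous (ltW ab) fi).
have [c _] := MVT_segment (ltW ab) GF' GFc.
rewrite mul0r => /eqP; rewrite subr_eq0 => /eqP.
rewrite /G/= !fctE {2}/parameterized_integral set_itv1 Rintegral_set1 sub0r.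
by move=> /eqP; rewrite subr_eq addrC => /eqP.
Qed.

Section JacobiMeasure.
Context {R : realType}.
Implicit Types (a b c : R) (h : {poly R}).
Local Notation mu := (@lebesgue_measure R).

Definition jacobi_weight a b (x : R) : R := (1 - x) `^ a * (1 + x) `^ b.

Lemma jacobi_weight_ge0 a b x : 0 <= jacobi_weight a b x.
Proof. by rewrite mulr_ge0 ?powR_ge0. Qed.

Lemma measurable_jacobi_weight a b : measurable_fun setT (jacobi_weight a b).
Proof.
apply: measurable_funM; apply: (measurableT_comp (measurable_powR _)).
  exact: measurable_funB.
exact: measurable_funD.
Qed.

Lemma powR_cvg0_comp (T : Type) (F : set_system T) (FF : Filter F)
    (g : T -> R) (s : R) :
  0 < s -> (\forall x \near F, 0 < g x) -> g x @[x --> F] --> 0 ->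
  g x `^ s @[x --> F] --> 0.
Proof.
move=> s0 g0 gF A /(powR_cvg0 s0); rewrite nbhs_simpl => /gF.
by rewrite !nbhs_simpl; apply: filterS2 g0 => x gx0 /(_ gx0).
Qed.

Lemma is_derive_powR_comp (g : R -> R) (s x dg : R) : 0 < g x ->
  is_derive x 1 g dg ->
  is_derive x 1 (fun y => g y `^ (s + 1)) ((s + 1) * g x `^ s * dg).
Proof.
move=> gx0 dgx; have dp := is_derive1_powR (s + 1) gx0.
by have := is_derive1_comp dp dgx; rewrite addrK.
Qed.

(** Raising both exponents by one multiplies the weight by 1 - x^2 on the open interval, so
    [pearson_op] appears by the product rule. *)
Lemma is_derive_jacobi_weight a b h (x : R) : -1 < x -> x < 1 ->
  is_derive x 1 (fun y => jacobi_weight (a + 1) (b + 1) y * h.[y])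
    (jacobi_weight a b x * (pearson_op a b h).[x]).
Proof.
move=> x_gtN1 x_lt1.
have x1 : 0 < 1 - x by lra.
have x2 : 0 < 1 + x by lra.
have d1 : is_derive x 1 (fun y : R => 1 - y) (-1).
  by rewrite -[-1]add0r; apply: is_deriveB.
have d2 : is_derive x 1 (fun y : R => 1 + y) 1.
  by rewrite -[X in is_derive _ _ _ X]add0r; apply: is_deriveD.
have dp1 := @is_derive_powR_comp (fun y => 1 - y) a x _ x1 d1.
have dp2 := @is_derive_powR_comp (fun y => 1 + y) b x _ x2 d2.
apply: (is_derive_eq (is_deriveM (is_deriveM dp1 dp2) (is_derive_poly h x))).
rewrite /jacobi_weight /pearson_op.
have powS (s t : R) : 0 < t -> t `^ (s + 1) = t `^ s * t.
  by move=> t0; rewrite powRD ?powRr1 ?ltW// (gt_eqF t0) implybT.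
rewrite ?fctE /GRing.scale/= !powS//.
rewrite !(hornerD, hornerN, hornerM, horner_exp, hornerX, hornerC).
ring.
Qed.

(** At each endpoint one base tends to 0 from above with positive exponent, while the other factors
    stay continuous. *)
Lemma continuous_jacobi_weight a b h : -1 < a -> -1 < b ->
  {within `[-1, 1], continuous
    (fun y => jacobi_weight (a + 1) (b + 1) y * h.[y])}.
Proof.
move=> a1 b1.
have powc (g : R -> R) (s x0 : R) : 0 < g x0 -> {for x0, continuous g} ->
    g x `^ s @[x --> x0] --> g x0 `^ s.
  move=> g0 gc; have pc : {for g x0, continuous (@powR R ^~ s)}.
    apply/differentiable_continuous/derivable1_diffP.
    by apply: derivable_powR; rewrite in_itv/= g0.
  exact: (cvg_comp g (@powR R ^~ s) gc pc).
have ltN11 : (-1 : R) < 1 by lra.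
apply/(continuous_within_itvP _ ltN11); split => [x||].
- rewrite in_itv/= => /andP[x1 x2].
  apply/differentiable_continuous/derivable1_diffP.
  by have [] := is_derive_jacobi_weight a b h x1 x2.
- rewrite /jacobi_weight addrN powR0 ?mulr0 ?mul0r; last by lra.
  rewrite -(mul0r h.[-1]) -(mulr0 ((1 - -1) `^ (a + 1))).
  apply: cvgM; last exact/cvg_at_right_filter/continuous_horner.
  apply: cvgM.
    apply: cvg_at_right_filter; apply: (powc (fun x => 1 - x)); first lra.
    by apply: cvgB; [exact: cvg_cst|exact: cvg_id].
  apply: powR_cvg0_comp; first lra.
    by near=> x; have : -1 < x by []; lra.
  apply: cvg_at_right_filter; rewrite -(addrN 1).
  by apply: cvgD; [exact: cvg_cst|exact: cvg_id].
- rewrite /jacobi_weight subrr powR0 ?mul0r; last by lra.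
  rewrite -(mul0r h.[1]) -(mul0r ((1 + 1) `^ (b + 1))).
  apply: cvgM; last exact/cvg_at_left_filter/continuous_horner.
  apply: cvgM; last first.
    apply: cvg_at_left_filter; apply: (powc (fun x => 1 + x)); first lra.
    by apply: cvgD; [exact: cvg_cst|exact: cvg_id].
  apply: powR_cvg0_comp; first lra.
    by near=> x; have : x < 1 by []; lra.
  apply: cvg_at_left_filter; rewrite -(subrr 1).
  by apply: cvgB; [exact: cvg_cst|exact: cvg_id].
Unshelve. all: by end_near. Qed.

End JacobiMeasure.

(** * Integration of polynomials against the Jacobi measure *)

Section JacobiMean.
Context {R : realType}.
Context (a b : R) (sigma : probability (measurableTypeR R) R).
Context (a1 : -1 < a) (b1 : -1 < b) (hsigma : jacobi_measure a b sigma).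
Local Notation mu := (@lebesgue_measure R).

Lemma jacobi_measure_integrable (p : {poly R}) :
  sigma.-integrable setT (fun x => (p.[x])%:E).
Proof.
have [c c0 sE] := hsigma.
have mI : measurable (`[-1, 1] : set (measurableTypeR R)) by [].
have mp : measurable_fun setT (horner p).
  by apply: continuous_measurable_fun; exact: continuous_horner.
(* Off the segment there is no mass, and on the compact segment a polynomial is bounded. *)
have s0 : sigma (~` `[-1, 1]%classic) = 0%E.
  by rewrite sE ?setICl ?integral_set0//; exact: measurableC.
apply/(negligible_integrable (measurableC mI)) => //.
  exact/measurable_EFinP.
rewrite setTD setCK; apply: measurable_bounded_integrable => //.
- by rewrite ltey_eq fin_num_measure.
- exact: measurable_funTS.
- have pc : {within `[-1, 1], continuous (horner p)}.
    exact/continuous_subspaceT/continuous_horner.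
  have /compact_bounded[M [_ mrt]] :=
    continuous_compact pc (@segment_compact R (-1) 1).
  by exists M; split; rewrite ?num_real // => ? ? ? ?; exact: mrt.
Qed.

(** The Lebesgue integrand has a primitive vanishing at both ends. Its integrability comes from that
    of polynomials under [sigma], with no estimate of the weight. *)
Lemma jacobi_measure_pearson (h : {poly R}) :
  \int[sigma]_x (pearson_op a b h).[x] = 0.
Proof.
have a10 : a + 1 != 0 by rewrite gt_eqF// -ltrBlDr sub0r.
have b10 : b + 1 != 0 by rewrite gt_eqF// -ltrBlDr sub0r.
have [c c0 sE] := hsigma.
pose w : measurableTypeR R -> \bar R :=
  (fun x : R => (c * jacobi_weight a b x)%:E) \_ `[-1, 1]%classic.
have mI : measurable (`[-1, 1] : set (measurableTypeR R)) by [].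
have mw : measurable_fun [set: measurableTypeR R] w.
  apply/(measurable_restrictT _ mI)/measurable_funTS/measurable_EFinP.
  by apply: measurable_funM => //; exact: measurable_jacobi_weight.
have w0 (x : R) : (0 <= w x)%E.
  rewrite /w patchE; case: ifP => // _.
  by rewrite lee_fin mulr_ge0 ?jacobi_weight_ge0// ltW.
have sw A : measurable A -> (sigma A = \int[mu]_(x in A) w x)%E.
  by move=> mA; rewrite sE// integral_mkcondr.
have ip := jacobi_measure_integrable (pearson_op a b h).
have [] := density_integral mw w0 sw ip.
(* The normalising constant is absorbed into [h] by linearity. *)
set f := fun x => jacobi_weight a b x * (pearson_op a b (c *: h)).[x].
have -> : ((fun x => ((pearson_op a b h).[x])%:E) \* w)%E =
    (EFin \o f) \_ `[-1, 1]%classic.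
  apply/funext => x; rewrite /w !patchE /f/=; case: ifP => _.
    2: by rewrite mule0.
  rewrite -EFinM; congr EFin.
  have -> : pearson_op a b (c *: h) = c *: pearson_op a b h.
    by rewrite /pearson_op derivZ scalerDr !scalerAr.
  by rewrite hornerZ /jacobi_weight; ring.
move=> /(integrable_mkcond _ mI) fi; rewrite -integral_mkcond /Rintegral => ->.
pose F y := jacobi_weight (a + 1) (b + 1) y * (c *: h).[y].
have F'f (x : R) : x \in `]-1, 1[ -> is_derive x 1 F (f x).
  rewrite in_itv/= => /andP[x1 x2].
  exact: is_derive_jacobi_weight.
have Fc : {within `[-1, 1], continuous F}.
  exact: continuous_jacobi_weight.
have fc : {in `]-1, 1[, continuous f}.
  move=> x; rewrite in_itv/= => /andP[x1 x2].
  (* The weight is the primitive for exponents lowered by one and h = 1, so it is differentiable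
     inside. *)
  have cJ : {for x, continuous (jacobi_weight a b)}.
    have -> : jacobi_weight a b =
        fun y => jacobi_weight (a - 1 + 1) (b - 1 + 1) y * (1 : {poly R}).[y].
      by apply/funext => y; rewrite !subrK hornerC mulr1.
    apply/differentiable_continuous/derivable1_diffP.
    by have [] := is_derive_jacobi_weight (a - 1) (b - 1) 1 x1 x2.
  by apply: continuousM => //; exact: continuous_horner.
have ltN11 : (-1 : R) < 1 by lra.
rewrite -[LHS]/(\int[mu]_(x in `[-1, 1]) f x).
rewrite (integrable_FTC2 ltN11 fi fc F'f Fc).
by rewrite /F /jacobi_weight subrr !powR0// !(mulr0, mul0r) subrr.
Qed.

Definition jacobi_mean (p : {poly R}) : R := \int[sigma]_x p.[x].

Lemma jacobi_mean_linear : scalar jacobi_mean.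
Proof.
move=> k p q; rewrite /jacobi_mean.
transitivity (\int[sigma]_x (k * p.[x] + q.[x])).
  by apply: eq_Rintegral => x _; rewrite hornerD hornerZ.
have ip := jacobi_measure_integrable p.
have iq := jacobi_measure_integrable q.
rewrite RintegralD// ?RintegralZl//.
have := integrableZl measurableT k ip.
by apply: eq_integrable => // x _; rewrite EFinM.
Qed.

End JacobiMean.

(** * The associated polynomials *)

(** Norm and positivity fix [r 0]. For r_1 = u X + v, orthogonality to 1 gives v = - u E(X), then
    the norm gives u^2 D = 1; with u > 0 this yields both D > 0 and u. *)
Lemma orthonormal_first_two (K : rcfType) (E : {scalar {poly K}})
    (r : nat -> {poly K}) (D := E 'X^2 - E 'X ^+ 2) :
  (forall n, size (r n) = n.+1) -> (forall n, 0 < lead_coef (r n)) ->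
  (forall m n, E (r m * r n) = (m == n)%:R) -> E 1 = 1 ->
  [/\ 0 < D, r 0 = 1 &
      r 1 = (1 / Num.sqrt D) *: 'X - (E 'X / Num.sqrt D)%:P].
Proof.
move=> size_r lead_r Er E1.
have EC (k : K) : E k%:P = k by rewrite -alg_polyC scalarZ E1 mulr1.
have r0E : r 0 = ((r 0)`_0)%:P by apply: size1_polyC; rewrite size_r.
have r01 : r 0 = 1.
  have := lead_r 0; rewrite lead_coefE size_r /= => c0.
  have /eqP := Er 0 0; rewrite r0E -polyCM EC -expr2 eqxx sqrp_eq1 ?ltW//.
  by move=> /eqP ->.
pose u := (r 1)`_1; pose v := (r 1)`_0.
have u0 : 0 < u by have := lead_r 1; rewrite lead_coefE size_r.
have r1E : r 1 = u *: 'X + v%:P.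
  apply/polyP => -[|[|i]]; rewrite coefD coefZ coefX coefC /=.
  - by rewrite mulr0 add0r.
  - by rewrite mulr1 addr0.
  - by rewrite nth_default ?size_r// mulr0 addr0.
have uv : v = - (u * E 'X).
  have := Er 1 0; rewrite r01 mulr1 r1E linearD scalarZ EC /= => /eqP.
  by rewrite addrC addr_eq0 => /eqP.
have uD : u ^+ 2 * D = 1.
  have := Er 1 1; rewrite eqxx mulr1n r1E.
  have -> : (u *: 'X + v%:P) * (u *: 'X + v%:P) =
      (u ^+ 2) *: 'X^2 + (2 * u * v) *: 'X + (v ^+ 2)%:P.
    by rewrite -!mul_polyC !polyCM; ring.
  rewrite !linearD !scalarZ EC uv /= => <-; rewrite /D; ring.
have D0 : 0 < D by rewrite -(pmulr_rgt0 _ (exprn_gt0 2 u0)) uD.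
have uE : u = 1 / Num.sqrt D.
  have sD0 : 0 < Num.sqrt D by rewrite sqrtr_gt0.
  have /eqP : (u * Num.sqrt D) ^+ 2 = 1 by rewrite exprMn sqr_sqrtr// ltW.
  rewrite sqrp_eq1 ?mulr_ge0 ?ltW// => /eqP <-.
  by rewrite mulfK ?gt_eqF.
by split=> //; rewrite r1E uv -uE polyCN {2}uE mul1r mulrC.
Qed.

Theorem theorem6 (R : realType) (a b : R) (ha : -1 < a) (hb : -1 < b)
    (sigma : probability (measurableTypeR R) R)
    (hsigma : jacobi_measure a b sigma)
    (r : nat -> {poly R}) (hr : orthonormal_polynomials sigma r)
    (J3 : simx R) (hJ3 : jacobi_matrix_of r J3)
    (p : nat -> {poly R})
    (hp : associated_polynomials (pencil_of_jacobi sigma J3) p) :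
  [/\ jacobi_type_pencil (pencil_of_jacobi sigma J3),
      forall n : nat, p n = r n - (r n - (r n).[0]%:P) %/ 'X,
      forall n : nat,
        [/\ size (p n) = n.+1,
            solves_ode a b (n%:R * (n%:R + a + b + 1)) (p n)
          & forall y : {poly R}, size y = n.+1 ->
              solves_ode a b (n%:R * (n%:R + a + b + 1)) y ->
              exists c : R, y = c *: p n]
    & forall n : nat, exists! lambda : R,
        exists2 y : {poly R}, size y = n.+1 & solves_ode a b lambda y].
Proof.
have [size_r lead_r orth_r] := hr.
have lin := GRing.isLinear.Build R {poly R} R^o *%R (jacobi_mean sigma)
  (jacobi_mean_linear hsigma).
pose E : {scalar {poly R}} := HB.pack (jacobi_mean sigma) lin.
have Er m n : E (r m * r n) = (m == n)%:R.
  rewrite /E/= /jacobi_mean /Rintegral.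
  by under eq_integral do rewrite hornerM; rewrite orth_r.
have EX j : E 'X^j = moment sigma j.
  by apply: eq_Rintegral => x _; rewrite hornerXn.
have m0 : moment sigma 0 = 1.
  rewrite /moment; under eq_Rintegral do rewrite expr0.
  by rewrite Rintegral_cst// mul1r -[RHS]/(fine 1%E) -(probability_setT sigma).
have Epearson h : E (pearson_op a b h) = 0.
  exact: jacobi_measure_pearson.
have DE : Delta1 sigma = E 'X^2 - E 'X ^+ 2.
  by rewrite /Delta1 m0 mul1r -!EX.
have [D0 r0E r1E] := orthonormal_first_two size_r lead_r Er (etrans (EX 0) m0).
rewrite -DE in D0 r1E.
have HT : jacobi_type_pencil (pencil_of_jacobi sigma J3).
  split; first by rewrite /= divr_gt0 ?sqrtr_gt0.
    by case: hJ3.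
  by apply: five_diagonal_sqr; case: hJ3.
have pE : p = fun n => r n - (r n - (r n).[0]%:P) %/ 'X.
  apply: (associated_polynomials_unique HT hp); split.
  - by rewrite r0E hornerC subrr div0p subr0.
  (* The quotient of r_1 is its leading coefficient, which accounts for the extra 1 in the numerator
     of beta. *)
  - rewrite difference_quotient r1E.
    have -> : drop_poly 1 ((1 / Num.sqrt (Delta1 sigma)) *: 'X -
       (E 'X / Num.sqrt (Delta1 sigma))%:P) = (1 / Num.sqrt (Delta1 sigma))%:P.
      apply/polyP => i; rewrite coef_drop_poly coefB coefZ coefX !coefC addn1.
      by case: i => [|i] /=; rewrite subr0 ?mulr1 ?mulr0.
    by rewrite /= -addrA -opprD -polyCD -mulrDl -polyCN -EX expr1.
  - exact: recurrence_shift.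
have size_p n : size (p n) = n.+1.
  rewrite pE difference_quotient size_polyDl// size_polyN size_drop_poly.
  by rewrite size_r subn1.
have ode_p n : solves_ode a b (n%:R * (n%:R + a + b + 1)) (p n).
  (* Here X p_n = (X - 1) r_n + r_n(0), so the constant c is r_n(0). *)
  apply/solves_odeE; rewrite pE mulrBr mulX_difference_quotient opprB.
  rewrite addrCA addrC.
  have -> : 'X * r n - r n = ('X - 1) * r n by rewrite mulrBl mul1r.
  apply: shifted_op_deriv2.
  exact: (orthonormal_jacobi_op size_r Er Epearson).
split=> // n; first by rewrite pE.
  split=> // y sy yP; exact: (solves_ode_unique ha hb sy (size_p n) yP).
exists (n%:R * (n%:R + a + b + 1)); split; first by exists (p n).
by move=> l [y sy yP]; rewrite (solves_ode_eigenvalue sy yP).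
Qed.
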